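(* Let $G$ be a topological group whose topology is induced by a translation-invariant metric $d$. Let $\mu$ and $\nu$ be finite regular Borel measures on $G$, and let $\lambda\in\mathbb{R}$. If $\overline{\dim}_{loc}\mu(x)\le\lambda$ for all $x\in\operatorname{int}(\operatorname{supp}\mu)$, then $\overline{\dim}_{loc}(\mu*\nu)(z)\le\lambda$ for all $z\in\operatorname{int}(\operatorname{supp}\mu)\cdot\operatorname{supp}\nu=\{xy : x\in\operatorname{int}(\operatorname{supp}\mu),\ y\in\operatorname{supp}\nu\}$.
   Context: Translation-invariant means $d(gx,gy)=d(x,y)=d(xg,yg)$ for all $g,x,y\in G$. $B(x,r)$ is the ball of center $x$ and radius $r$. $\operatorname{supp}\mu$ is the support of $\mu$ (points all of whose open neighbourhoods have positive measure). For a measure $\mu$ on a metric space and $x\in\operatorname{supp}\mu$, the upper local dimension is $\overline{\dim}_{loc}\mu(x)=\limsup_{r\to0}\frac{\log(\mu(B(x,r)))}{\log r}$. The convolution is $(\mu*\nu)(A)=\int_G\int_G\chi_A(xy)\,d\mu(x)\,d\nu(y)$ for Borel $A\subset G$. *)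

(* Defs.v *)
From HB Require Import structures.
From mathcomp Require Import all_boot all_order all_algebra.
From mathcomp Require Import all_classical all_reals all_analysis.

Set Implicit Arguments.
Unset Strict Implicit.
Unset Printing Implicit Defensive.

Import Order.TTheory GRing.Theory Num.Theory.
Import numFieldNormedType.Exports.

Local Open Scope classical_set_scope.
Local Open Scope ring_scope.

HB.structure Definition PreTopologicalGroup :=
  {G of Topological G & monoid.Group G}.

HB.mixin Record PreTopologicalGroup_isTopologicalGroup G
    & PreTopologicalGroup G := {
  mulg_continuous : continuous (fun x : G * G => (x.1 * x.2)%g) ;
  invg_continuous : continuous (fun x : G => (x^-1)%g)
}.

#[short(type="topologicalGroupType")]
HB.structure Definition TopologicalGroup :=
  {G of PreTopologicalGroup G & PreTopologicalGroup_isTopologicalGroup G}.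

#[short(type="metricGroupType")]
HB.structure Definition MetricGroup (R : numDomainType) :=
  {G of TopologicalGroup G & Metric R G}.

Definition translation_invariant (R : numDomainType) (G : metricGroupType R) :=
  forall g x y : G, mdist (g * x)%g (g * y)%g = mdist x y :> R /\
                    mdist (x * g)%g (y * g)%g = mdist x y :> R.

(* A group is inhabited, which the library requires of a generated
   sigma-algebra; the alias carries this without making G pointed. *)
Definition borelType (G : topologicalGroupType) : Type := G.

Section borel_sigma_algebra.
Variable G : topologicalGroupType.

HB.instance Definition _ := Choice.on (borelType G).
HB.instance Definition _ := isPointed.Build (borelType G) (1%g : G).
HB.instance Definition _ := @isMeasurable.Build (sigma_display (@open G))
  (borelType G) <<s @open G >>
  (@sigma_algebra0 _ setT (@open G))
  (@sigma_algebraC (borelType G) (@open G))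
  (@sigma_algebra_bigcup _ setT (@open G)).

End borel_sigma_algebra.

Section measures_on_groups.
Local Open Scope ereal_scope.

Definition regular (R : realType) (G : topologicalGroupType)
    (mu : {measure set (borelType G) -> \bar R}) :=
  forall A : set G, measurable (A : set (borelType G)) ->
    mu A = ereal_inf [set mu U | U in [set U : set G | open U /\ A `<=` U]] /\
    mu A = ereal_sup [set mu K | K in [set K : set G | compact K /\ K `<=` A]].

Definition supp (R : realType) (T : topologicalType) (mu : set T -> \bar R) :
    set T :=
  [set x | forall U : set T, open U -> U x -> 0 < mu U].

(* lne 0 = -oo, so a point having a null ball gets dimension +oo: a finite
   bound on [upper_local_dim mu x] forces x to lie in the support of mu. *)
Definition upper_local_dim (R : realType) (T : metricType R)
    (mu : set T -> \bar R) (x : T) : \bar R :=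
  limf_esup (fun r : R => lne (mu (ball x r)) / (ln r)%:E) 0^'+.

Definition convolution (R : realType) (G : topologicalGroupType)
    (mu nu : {measure set (borelType G) -> \bar R}) (A : set G) : \bar R :=
  \int[nu]_y \int[mu]_x (\1_A ((x : G) * (y : G))%g)%:E.

End measures_on_groups.

(* Main.v *)
Require Import Defs.
From HB Require Import structures.
From mathcomp Require Import all_boot all_order all_algebra.
From mathcomp Require Import all_classical all_reals all_analysis.
From mathcomp Require Import measurable_realfun.

Set Implicit Arguments.
Unset Strict Implicit.
Unset Printing Implicit Defensive.

Import Order.TTheory GRing.Theory Num.Theory.
Import numFieldNormedType.Exports.

Local Open Scope classical_set_scope.
Local Open Scope ring_scope.

(** By translation invariance, [x y] lies in [B(z, r)] iff [x] lies in
    [B(z y^-1, r)], so [(mu * nu)(B(z, r))] is the [nu]-integral over [y] of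
    [mu(B(z y^-1, r))] ([convolution_ball]). Let [z = x0 y0] and let [U] be the
    set of the [y] such that [z y^-1] is interior to the support of [mu]. It is
    an open neighbourhood of [y0], hence [nu(U) > 0].

    A bound [lam] on the upper local dimension at [x] means that, for every
    [a > lam], one has [mu(B(x, r)) > r^a] for all small [r]
    ([upper_local_dim_leP]); using an exponent strictly between [lam] and [a],
    it even implies that [r^(-a) mu(B(x, r))] tends to infinity as [r] tends
    to [0] ([upper_local_dim_cvgy]). The threshold on [r] depends on [x], and
    Fatou's lemma takes the place of uniformity: if the bound failed at [z] for
    some [a > lam], there would be radii [r_n] tending to [0] such that
    [r_n^(-a) (mu * nu)(B(z, r_n)) <= 1]. On [U] the integrands
    [r_n^(-a) mu(B(z y^-1, r_n))] tend to infinity, so their lower limit has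
    infinite integral, whereas their integrals are at most [1].

    Fatou's lemma needs [y |-> mu(B(z y^-1, r))] to be measurable: the mass of
    an open ball of fixed radius is a lower semicontinuous function of its
    centre ([lower_semicontinuous_measure_ball]). *)

(** A property that holds at some term of every sequence of positive reals
    tending to [0] holds for all small positive reals. *)
Lemma near_at_right0_seq (R : realType) (P : R -> Prop) :
  (forall u : nat -> R, (forall n, 0 < u n) -> u n @[n --> \oo] --> 0^'+ ->
    exists n, P (u n)) ->
  \forall r \near 0^'+, P r.
Proof.
move=> seqP; apply: contrapT => nP.
have bad (n : nat) : exists r : R, [/\ 0 < r, r < n.+1%:R^-1 & ~ P r].
  apply: contrapT => nex; apply: nP; near=> r.
  have r0 : 0 < r by [].
  have rn : r < n.+1%:R^-1 by near: r; apply: nbhs_right_lt; rewrite invr_gt0.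
  by apply: contrapT => nPr; apply: nex; exists r.
pose u n := sval (cid (bad n)).
have uP n : [/\ 0 < u n, u n < n.+1%:R^-1 & ~ P (u n)] by rewrite /u; case: cid.
have [n|A nA|n Pn] := seqP u; [by have [] := uP n| |by have [] := uP n].
case: nA => e /= e0 eA; change (\forall n \near \oo, A (u n)).
near=> n; have [u0 un _] := uP n.
apply: eA => //=; rewrite sub0r normrN gtr0_norm// (lt_trans un)//.
by near: n; exact: (near_infty_natSinv_lt (PosNum e0)).
Unshelve. all: by end_near. Qed.

(** Division by the negative number [ln r] reverses the inequality. A null [m]
    is covered: its quotient is then [+oo] and both sides are false. *)
Lemma lne_div_ln_lt (R : realType) (r a : R) (m : \bar R) :
  0 < r < 1 -> (0 <= m)%E ->
  (lne m / (ln r)%:E < a%:E)%E = ((r `^ a)%:E < m)%E.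
Proof.
move=> /andP[r0 r1] m0; have lr : ln r < 0 by rewrite ln_lt0// r0.
rewrite inver lt_eqF// lte_ndivrMr// -EFinM -ln_powR -lne_EFin ?powR_gt0//.
by rewrite lte_lne// in_itv/= ?leey ?andbT// lee_fin powR_ge0.
Qed.

(** The upper local dimension in terms of the mass of small balls. *)
Lemma upper_local_dim_leP (R : realType) (T : metricType R)
    (mu : set T -> \bar R) (x : T) (lam : R) :
  (forall A, 0 <= mu A)%E ->
  (upper_local_dim mu x <= lam%:E)%E <->
  forall a, lam < a -> \forall r \near 0^'+, ((r `^ a)%:E < mu (ball x r))%E.
Proof.
move=> mu0; split=> [dim a lama|near_mu].
  have : (upper_local_dim mu x < a%:E)%E.
    by rewrite (le_lt_trans dim)// lte_fin.
  move=> /ereal_inf_lt[_ [V V0 <-] supV]; near=> r.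
  rewrite -lne_div_ln_lt//.
    apply: le_lt_trans supV; apply: ereal_sup_ubound; exists r => //.
    by near: r.
  by apply/andP; split.
apply/lee_addgt0Pr => e e0; rewrite -EFinD.
have /near_mu {}near_mu : lam < lam + e by rewrite ltrDl.
apply: ge_ereal_inf.
exists (ereal_sup [set (lne (mu (ball x r)) / (ln r)%:E)%E |
    r in [set r : R | 0 < r < 1 /\ ((r `^ (lam + e))%:E < mu (ball x r))%E]]).
  eexists; last reflexivity.
  by near=> r; split; [apply/andP; split|near: r].
apply: ge_ereal_sup => _ [r [r01 rmu] <-].
by rewrite ltW// lne_div_ln_lt.
Unshelve. all: by end_near. Qed.

Lemma powRN_cvgy (R : realType) (c : R) :
  0 < c -> (r `^ (- c))%:E @[r --> 0^'+] --> +oo%E.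
Proof.
move=> c0; apply/cvgeyPgt => A; near=> r; rewrite lte_fin powRN.
have r0 : 0 < r by [].
have A0 : 0 < `|A| + 1 by rewrite ltr_wpDl.
have rA : r `^ c < (`|A| + 1)^-1.
  by near: r; apply: (cvgr_lt 0); [exact: powR_cvg0|rewrite invr_gt0].
apply: (@lt_trans _ _ (`|A| + 1)); first by rewrite ltr_pwDr// ler_norm.
by rewrite -ltf_pV2 ?posrE ?invr_gt0 ?powR_gt0// invrK.
Unshelve. all: by end_near. Qed.

Lemma upper_local_dim_cvgy (R : realType) (T : metricType R)
    (mu : set T -> \bar R) (x : T) (lam a : R) :
  (forall A, 0 <= mu A)%E -> (upper_local_dim mu x <= lam%:E)%E -> lam < a ->
  ((r `^ (- a))%:E * mu (ball x r))%E @[r --> 0^'+] --> +oo%E.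
Proof.
move=> mu0 /(upper_local_dim_leP _ _ mu0) near_mu lama.
have [lamb ba] := midf_lt lama.
(* The mass exceeds r^b, which leaves a factor r^(b - a) tending to infinity. *)
pose b := (lam + a) / 2.
have ab0 : 0 < a - b by rewrite subr_gt0.
apply: gee_cvgy (powRN_cvgy ab0).
near=> r; have r0 : 0 < r by [].
rewrite opprB addrC powRD ?(gt_eqF r0) ?implybT// EFinM.
apply: lee_wpmul2l; first by rewrite lee_fin powR_ge0.
by apply: ltW; near: r; exact: near_mu.
Unshelve. all: by end_near. Qed.

Lemma ball_open_metric (R : realType) (T : metricType R) (x : T) (r : R) :
  open (ball x r).
Proof.
rewrite openE => y; rewrite /interior ballEmdist/= => xy.
apply/nbhs_ballP; exists (r - mdist x y); first by rewrite /= subr_gt0.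
move=> w; rewrite !ballEmdist/= ltrBrDl; exact/le_lt_trans/metric_triangle.
Qed.

Section metric_group.
Context {R : realType} {G : metricGroupType R}.
Implicit Types (mu nu : {measure set (borelType G) -> \bar R}).

Lemma open_borel (U : set G) : open U -> measurable (U : set (borelType G)).
Proof. by move=> oU; apply: sub_sigma_algebra. Qed.

Lemma measurable_ball_borel (x : G) (r : R) :
  measurable (ball x r : set (borelType G)).
Proof. by apply: open_borel; exact: ball_open_metric. Qed.

Lemma lower_semicontinuous_measure_ball mu (r : R) :
  lower_semicontinuous (fun w : G => mu (ball w r)).
Proof.
move=> w a aw.
(* Continuity from below along concentric balls of radii increasing to r: one
   of them already has mass above a, and it is contained in the balls of
   radius r whose centres are close enough to w. *)
pose F n : set (borelType G) := ball w (r - n.+1%:R^-1).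
have FE : \bigcup_n F n = ball w r.
  apply/seteqP; split=> [y [n _]|y].
    rewrite /F !ballEmdist/= => /lt_le_trans; apply.
    by rewrite gerBl.
  rewrite ballEmdist/= -subr_gt0 => d0.
  have [n _ /(_ n (leqnn n))/= nd] := near_infty_natSinv_lt (PosNum d0).
  by exists n => //; rewrite /F ballEmdist/= ltrBrDr -ltrBrDl.
have [n an] : exists n, (a%:E < mu (F n))%E.
  apply: contrapT => /forallNP nF; move: aw; rewrite ltNge => /negP; apply.
  have cF : mu (F n) @[n --> \oo] --> mu (ball w r).
    rewrite -FE; apply: nondecreasing_cvg_mu => [i||i j ij].
    - exact: measurable_ball_borel.
    - by rewrite FE; exact: measurable_ball_borel.
    - apply/subsetPset; apply: le_ball; rewrite lerB//.
      by rewrite lef_pV2 ?posrE// ler_nat ltnS.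
  rewrite -(cvg_lim _ cF)//; apply: lime_le; first exact: cvgP cF.
  by apply: nearW => n; rewrite leNgt; apply/negP/nF.
exists (ball w n.+1%:R^-1); first by apply: nbhsx_ballx; rewrite invr_gt0.
move=> v wv; apply: (lt_le_trans an); apply: le_measure.
- by rewrite inE; exact: measurable_ball_borel.
- by rewrite inE; exact: measurable_ball_borel.
- move=> y wy; have := ball_triangle (ball_sym wv) wy.
  by rewrite addrC subrK.
Qed.

Lemma mulgV_continuous (z : G) : continuous (fun y : G => (z / y)%g).
Proof.
move=> y; apply: (@continuous_comp G (G * G)%type G (fun y => (z, y^-1)%g)
  (fun p => (p.1 * p.2)%g) y); last exact: mulg_continuous.
by apply: (@cvg_pair); [exact: cvg_cst|exact: invg_continuous].
Qed.

Lemma measurable_measure_ball mu (z : G) (r : R) :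
  measurable_fun [set: borelType G]
    (fun y : borelType G => mu (ball (z / (y : G))%g r)).
Proof.
apply: (measurability _ (ErealGenOInfty.measurableE R)).
move=> /= _ [_ [a ->]] <-; rewrite setTI preimage_itvoy; apply: open_borel.
have /lower_semicontinuousP/(_ a) := @lower_semicontinuous_measure_ball mu r.
by move/(open_comp (fun y _ => @mulgV_continuous z y)).
Qed.

Lemma convolution_ge0 mu nu (A : set G) : (0 <= convolution mu nu A)%E.
Proof.
apply: integral_ge0 => y _; apply: integral_ge0 => x _.
by rewrite lee_fin.
Qed.

Lemma convolution_ball (Ginv : translation_invariant G) mu nu (z : G) (r : R) :
  convolution mu nu (ball z r) =
  (\int[nu]_y mu (ball (z / (y : G))%g r))%E.
Proof.
apply: eq_integral => y _.
rewrite -[in RHS](setIT (ball _ _)) -integral_indic//; last first.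
  exact: measurable_ball_borel.
apply: eq_integral => x _; congr (_%:E).
rewrite !indicE; congr (nat_of_bool _)%:R.
apply/idP/idP; rewrite !inE !ballEmdist/=.
  by rewrite -(Ginv (y : G) (z * _)%g x).2 divgK.
by rewrite -(Ginv (y : G) (z * _)%g x).2 divgK.
Qed.

End metric_group.

Theorem theorem1p1 (R : realType) (G : metricGroupType R)
  (Ginv : translation_invariant G)
  (mu nu : {finite_measure set (borelType G) -> \bar R})
  (mu_reg : regular mu) (nu_reg : regular nu) (lam : R) :
  (forall x : G, (supp (mu : set G -> \bar R))° x ->
     (upper_local_dim (mu : set G -> \bar R) x <= lam%:E)%E) ->
  forall z : G,
    [set (x * y)%g | x in (supp (mu : set G -> \bar R))°
                   & y in supp (nu : set G -> \bar R)] z ->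
    (upper_local_dim (convolution mu nu) z <= lam%:E)%E.
Proof.
move=> dim_mu z [x0 x0S [y0 y0S <-{z}]]; set z := (x0 * y0)%g.
apply/upper_local_dim_leP; first exact: convolution_ge0.
move=> a lama; apply: near_at_right0_seq => u u0 ucvg.
apply: contrapT => /forallNP small.
pose U : set G := (fun y => z / y)%g @^-1` (supp (mu : set G -> \bar R))°.
have oU : open U.
  by apply: open_comp (@open_interior _ _) => y _; exact: mulgV_continuous.
have mU : measurable (U : set (borelType G)) := open_borel oU.
have nuU : (0 < nu U)%E.
  by apply: y0S => //; rewrite /U /= /z mulgK.
(* The rescaled integrands, to which Fatou's lemma is applied on U. *)
pose g n (y : borelType G) :=
  ((u n `^ (- a))%:E * mu (ball (z / (y : G))%g (u n)))%E.
have mg n : measurable_fun (U : set (borelType G))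
    (fun y : borelType G => mu (ball (z / (y : G))%g (u n))).
  by apply: measurable_funTS; exact: measurable_measure_ball.
have int_g n : (\int[nu]_(y in U) g n y <= 1)%E.
  rewrite ge0_integralZl// ?lee_fin ?powR_ge0//.
  rewrite powRN lee_pdivrMl ?powR_gt0// mule1.
  have := small n; rewrite convolution_ball// => /negP; rewrite -leNgt.
  apply: le_trans; apply: ge0_subset_integral => //.
  exact: measurable_measure_ball.
have g_infty y : U y -> limn_einf (g^~ y) = +oo%E.
  move=> Uy.
  suff /cvg_limn_einf_sup[] : g n y @[n --> \oo] --> +oo%E by [].
  exact: cvg_comp ucvg (upper_local_dim_cvgy _ (dim_mu _ Uy) lama).
(* The lower limit of the integrands is infinite on U, which has positive
   measure. *)
have := @fatou _ _ _ nu _ mU g.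
rewrite (eq_integral (cst +oo%E)); last by move=> y; rewrite inE => /g_infty.
rewrite integral_cst// gt0_mulye// leye_eq => fat.
have : (limn_einf (fun n => \int[nu]_(y in U) g n y) = +oo)%E.
  apply/eqP/fat => n; first exact: measurable_funeM.
  by move=> y _; apply: mule_ge0 => //; rewrite lee_fin powR_ge0.
apply/eqP; rewrite -ltey (@le_lt_trans _ _ 1%E)// ?ltry//.
rewrite limn_einf_lim; apply: lime_le; first exact: is_cvg_einfs.
apply: nearW => n; apply: le_trans (int_g n).
by apply: ereal_inf_lbound; exists n => /=.
Qed.
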